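(* Let $Q$ be a differentially closed quasifield. The Baire property holds for irreducible quasivarieties over $Q$: if $X\subseteq Q^n$ is an irreducible quasivariety, then the intersection of any countable family of dense open subsets of $X$ is not empty.
   Context: A differential ring is a commutative associative unital ring with a fixed finite nonempty set $\Delta$ of pairwise commuting derivations (the same $\Delta$ for all rings). $\Theta$ is the free commutative monoid generated by $\Delta$, acting as derivative operators. All rings have nonzero characteristic. A quasifield is a nonzero differential ring of nonzero characteristic whose only differential ideals are $0$ and the whole ring. $Q\{y_1,\ldots,y_n\}$ is the polynomial ring over $Q$ in the $\theta y_i$ ($\theta\in\Theta$, $1\le i\le n$) with the obvious derivations. For $E\subseteq Q\{y_1,\ldots,y_n\}$, $V(E)\subseteq Q^n$ is the set of common zeros of $E$; for $X\subseteq Q^n$, $I(X)$ is the set of differential polynomials vanishing on $X$. For a differential ideal $\mathfrak a$, $\mathfrak{rad}(\mathfrak a)=\{f\mid\theta f\text{ is nilpotent modulo }\mathfrak a\text{ for all }\theta\in\Theta\}$. $Q$ is differentially closed if $\mathfrak{rad}(\mathfrak a)=I(V(\mathfrak a))$ for every $n$ and every differential ideal $\mathfrak a$ of $Q\{y_1,\ldots,y_n\}$. A quasivariety in $Q^n$ is a subset of the form $V(E)$. The sets $V(E)$ are the closed sets of a topology on $Q^n$, and quasivarieties carry the subspace topology. Irreducible is meant in the topological sense (nonempty, and not the union of two proper closed subsets). *)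

(* Defs.v *)
From HB Require Import structures.
From mathcomp Require Import all_boot all_algebra.
From mathcomp Require Import finmap ring.
From mathcomp Require Import monalg.
From mathcomp Require Import boolp classical_sets cardinality.
From mathcomp Require Import topology_structure initial_topology.
From mathcomp Require Import subtype_topology.

Set Implicit Arguments.
Unset Strict Implicit.
Unset Printing Implicit Defensive.

Import GRing.Theory.
Local Open Scope classical_set_scope.
Local Open Scope ring_scope.

Local Notation "1" := (@mone _) : monom_scope.
Local Notation "x * y" := (mmul x y) : monom_scope.

HB.mixin Record ComNzRing_isDifferential (Delta : finType) R
    & GRing.ComNzRing R := {
  der : Delta -> R -> R;
  derD : forall d x y, der d (x + y) = der d x + der d y;
  derM : forall d x y, der d (x * y) = der d x * y + x * der d y;
  derC : forall d e x, der d (der e x) = der e (der d x)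
}.

#[short(type="diffRingType")]
HB.structure Definition DiffRing (Delta : finType) :=
  { R of ComNzRing_isDifferential Delta R & GRing.ComNzRing R }.

Section DiffRing.
Context {Delta : finType} (R : diffRingType Delta).

Definition diff_ideal (I : set R) : Prop :=
  [/\ I 0,
      forall x y, I x -> I y -> I (x + y),
      forall a x, I x -> I (a * x) &
      forall d x, I x -> I (der d x)].

(* [{cmonom Delta}] is the free commutative monoid generated by [Delta]; since
   the derivations commute, the order of composition is irrelevant. *)
Definition dop (t : {cmonom Delta}) (x : R) : R :=
  foldr (fun d => iter (t d) (der d)) x (enum Delta).

Definition drad (a : set R) : set R :=
  [set f | forall t : {cmonom Delta}, exists k : nat, a (dop t f ^+ k)].

Lemma der_is_additive d : additive (der d : R -> R).
Proof.
have d0 : der d (0 : R) = 0.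
  by apply: (addrI (der d 0)); rewrite -derD !addr0.
move=> x y; rewrite derD; congr (_ + _).
by apply/eqP; rewrite -subr_eq0 opprK -derD addNr d0.
Qed.

HB.instance Definition _ d :=
  GRing.isAdditive.Build R R (der d) (der_is_additive d).

Lemma der1 d : der d (1 : R) = 0.
Proof.
have := derM d (1 : R) 1; rewrite !mulr1 mul1r => /eqP.
by rewrite -subr_eq0 opprD addrA subrr add0r oppr_eq0 => /eqP.
Qed.

Lemma der_iter d e k (x : R) :
  der d (iter k (der e) x) = iter k (der e) (der d x).
Proof. by elim: k => //= k <-; rewrite derC. Qed.

Lemma dop1 (x : R) : dop 1%M x = x.
Proof. by rewrite /dop; elim: (enum _) => //= d s ->; rewrite cm1. Qed.

Lemma dop0 t : dop t 0 = 0.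
Proof.
rewrite /dop; elim: (enum _) => //= d s ->.
by elim: (t d) => //= k ->; rewrite raddf0.
Qed.

Lemma dopU (d : Delta) t (x : R) : dop (ucm d * t)%M x = der d (dop t x).
Proof.
rewrite /dop; have : d \in enum Delta by rewrite mem_enum.
have := enum_uniq Delta.
elim: (enum Delta) => //= e s IH /andP[es us]; rewrite in_cons cmM cmU.
have [-> _|de] := eqVneq d e; last first.
  by rewrite /= add0n => ds; rewrite IH // der_iter.
rewrite /=; congr (der _ (iter _ _ _)); clear IH us.
elim: s es => //= f s IH; rewrite in_cons negb_or => /andP[df fs].
by rewrite IH // cmM cmU (negbTE df).
Qed.

End DiffRing.

(* Nontriviality of a quasifield is inherited from [comNzRingType]. *)
HB.mixin Record DiffRing_isQuasifield (Delta : finType) Q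
    & DiffRing Delta Q := {
  char_neq0 : exists2 m : nat, (0 < m)%N & m%:R = 0 :> Q;
  diff_simple : forall I : set Q, diff_ideal I -> I = [set 0] \/ I = setT
}.

#[short(type="quasifieldType")]
HB.structure Definition Quasifield (Delta : finType) :=
  { Q of DiffRing_isQuasifield Delta Q & DiffRing Delta Q }.

(* Stated over an abstract ring: on [{malg _}] itself, failed unifications
   unfold the ring operations and do not terminate in reasonable time. *)
Section AbstractLeibniz.
Context (A : comNzRingType) (D E : A -> A).
Hypothesis DD : forall f g, D (f + g) = D f + D g.

Lemma leibnizDl f f' g :
  D (f * g) = D f * g + f * D g -> D (f' * g) = D f' * g + f' * D g ->
  D ((f + f') * g) = D (f + f') * g + (f + f') * D g.
Proof. by move=> fg f'g; rewrite mulrDl !DD fg f'g; ring. Qed.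

Lemma leibnizDr f g g' :
  D (f * g) = D f * g + f * D g -> D (f * g') = D f * g' + f * D g' ->
  D (f * (g + g')) = D f * (g + g') + f * D (g + g').
Proof. by move=> fg fg'; rewrite mulrDr !DD fg fg'; ring. Qed.

Lemma leibniz0l g : D (0 * g) = D 0 * g + 0 * D g.
Proof.
have D0 : D 0 = 0 by apply: (addrI (D 0)); rewrite -DD !addr0.
by rewrite !mul0r D0 mul0r addr0.
Qed.

Lemma leibniz0r f : D (f * 0) = D f * 0 + f * D 0.
Proof.
have D0 : D 0 = 0 by apply: (addrI (D 0)); rewrite -DD !addr0.
by rewrite !mulr0 D0 mulr0 addr0.
Qed.

Lemma leibniz_mul a b x y p q da db dx dy :
  D (a * x) = da * x + a * dx -> D (b * y) = db * y + b * dy ->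
  p = a * b -> q = x * y ->
  D (p * q) = (da * b + a * db) * q + p * (dx * y + x * dy) ->
  D (a * x * (b * y)) = D (a * x) * (b * y) + a * x * D (b * y).
Proof. by move=> -> -> -> ->; rewrite mulrACA => ->; ring. Qed.

Lemma leibniz_morph (B : comNzRingType) (h : B -> A) (DB : B -> B) f g :
  (forall f g, h (f + g) = h f + h g) -> (forall f g, h (f * g) = h f * h g) ->
  (forall f g, DB (f * g) = DB f * g + f * DB g) ->
  (forall f g, D (f * g) = D f * g + f * D g) ->
  h (DB f) = D (h f) -> h (DB g) = D (h g) -> h (DB (f * g)) = D (h (f * g)).
Proof. by move=> hD hM BM DM fE gE; rewrite BM hD !hM DM fE gE. Qed.

Hypothesis DM : forall f g, D (f * g) = D f * g + f * D g.
Hypothesis ED : forall f g, E (f + g) = E f + E g.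
Hypothesis EM : forall f g, E (f * g) = E f * g + f * E g.

Lemma der_commD f g : D (E f) = E (D f) -> D (E g) = E (D g) ->
  D (E (f + g)) = E (D (f + g)).
Proof. by move=> fC gC; rewrite !(ED, DD) fC gC. Qed.

Lemma der_commM f g : D (E f) = E (D f) -> D (E g) = E (D g) ->
  D (E (f * g)) = E (D (f * g)).
Proof. by move=> fC gC; rewrite !(EM, DM, ED, DD) fC gC; ring. Qed.

End AbstractLeibniz.

(* A derivation of a polynomial ring (in a possibly infinite set of variables)
   is determined by its restriction [dR] to the coefficients and by the images
   [dI] of the variables. *)
Section PolyDerivation.
Context (I : choiceType) (R : comNzRingType).
Context (dR : R -> R) (dI : I -> {malg R[{cmonom I}]}).
Implicit Types (v : I) (m : {cmonom I}).

Local Notation P := {malg R[{cmonom I}]}.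

(* [\sum_v (m v) * (m / v) * (dI v)] *)
Definition monom_der m : P :=
  \sum_(v <- finsupp m) << (m v)%:R *g divcm m (ucm v) >> * dI v.

Definition poly_der (f : P) : P :=
  \sum_(m <- msupp f) (<< dR f@_m *g m >> + (f@_m)%:MP * monom_der m).

Lemma malgU_congr (c : R) m m' : m = m' -> << c *g m >> = << c *g m' >> :> P.
Proof. by move=> ->. Qed.

Lemma malgUU (a b : R) m m' :
  << a *g m >> * << b *g m' >> = << a * b *g (m * m')%M >> :> P.
Proof. by rewrite malgM_def fgmulUU. Qed.

Lemma malgU1 (a : R) m m' :
  << a *g m >> * << m' >> = << a *g (m * m')%M >> :> P.
Proof. by rewrite malgUU mulr1. Qed.

Lemma malg1U (a : R) m m' :
  << m >> * << a *g m' >> = << a *g (m * m')%M >> :> P.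
Proof. by rewrite malgUU mul1r. Qed.

Lemma malgUM m m' : << m >> * << m' >> = << (m * m')%M >> :> P.
Proof. by rewrite malgUU mulr1. Qed.

Lemma malgCU (c : R) m : c%:MP * << m >> = << c *g m >> :> P.
Proof. by rewrite malgUU mulr1 mul1m. Qed.

Lemma malg_ind (p : P -> Prop) : p 0 -> (forall f g, p f -> p g -> p (f + g)) ->
  (forall c m, p (c%:MP * << m >>)) -> forall f, p f.
Proof.
move=> p0 pD pU f; rewrite [f]monalgE; elim/big_ind: _ => // m _.
by rewrite -malgCU; apply: pU.
Qed.

Lemma cmonom_ind (p : {cmonom I} -> Prop) :
  p 1%M -> (forall v m, p m -> p (ucm v * m)%M) -> forall m, p m.
Proof.
move=> p1 pM m; move: {2}(mdeg m) (erefl (mdeg m)) => k.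
elim: k m => [|k IH] m mk; first by rewrite (mdeg_eq0I mk).
have [v vm] : exists v, m v != 0%N.
  apply: contrapT => m0; move: mk; suff -> : m = 1%M by rewrite mdeg1.
  by apply/eqP/cmP => v; rewrite cm1; apply/eqP; apply: contra_notT m0; exists v.
have mE : m = (ucm v * divcm m (ucm v))%M.
  apply/eqP/cmP => w; rewrite cmM divcmE cmU; case: eqVneq => [<-|_].
    by rewrite subnKC // lt0n.
  by rewrite subn0.
rewrite mE; apply/pM/IH; apply: succn_inj; rewrite -mk {2}mE.
by rewrite mdegM mdegU.
Qed.

Lemma monom_derEw m (E : {fset I}) : (finsupp m `<=` E)%fset ->
  monom_der m = \sum_(v <- E) << (m v)%:R *g divcm m (ucm v) >> * dI v.
Proof.
move=> mE; rewrite /monom_der (big_fset_incl _ mE) // => v _.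
by rewrite -cmE_neq0 negbK => /eqP ->; rewrite monalgU0 mul0r.
Qed.

Lemma monom_derM m m' : monom_der (m * m')%M
  = monom_der m * << m' >> + << m >> * monom_der m'.
Proof.
pose E := (finsupp m `|` finsupp m')%fset.
rewrite (@monom_derEw m E) ?fsubsetUl // (@monom_derEw m' E) ?fsubsetUr //.
rewrite (@monom_derEw (m * m')%M E) ?mdomD //.
rewrite mulr_suml [X in _ = _ + X]mulr_sumr -big_split /=.
have mulE (x y z w a b : P) : x = y * a + b * z ->
    x * w = y * w * a + b * (z * w) by move=> ->; ring.
apply: eq_bigr => v _; apply: (mulE _ _ _ (dI v)).
rewrite cmM natrD monalgUD [X in _ = X + _]malgU1 [X in _ = _ + X]malg1U.
have addE (x y z w : P) : x = z -> y = w -> x + y = z + w by move=> -> ->.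
apply: addE.
  have [->|mv] := eqVneq (m v) 0%N; first by rewrite !monalgU0.
  apply: malgU_congr; apply/eqP/cmP => w; rewrite !(cmM, divcmE, cmU).
  case: eqVneq => [<-|_]; last by rewrite !subn0.
  by rewrite addnBAC ?lt0n.
have [->|mv] := eqVneq (m' v) 0%N; first by rewrite !monalgU0.
apply: malgU_congr; apply/eqP/cmP => w; rewrite !(cmM, divcmE, cmU).
case: eqVneq => [<-|_]; last by rewrite !subn0.
by rewrite addnBA ?lt0n.
Qed.

Lemma monom_derU v : monom_der (ucm v) = dI v.
Proof.
have divUU : divcm (ucm v) (ucm v) = 1%M.
  by apply/eqP/cmP => w; rewrite divcmE subnn cm1.
rewrite /monom_der mdomU big_seq_fset1 cmUU divUU; exact: mul1r.
Qed.

Lemma monom_der1 : monom_der 1%M = 0.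
Proof. by rewrite /monom_der mdom1 big_seq_fset0. Qed.

Hypothesis dRD : forall a b, dR (a + b) = dR a + dR b.
Hypothesis dRM : forall a b, dR (a * b) = dR a * b + a * dR b.

Lemma dR0 : dR 0 = 0.
Proof. by apply: (addrI (dR 0)); rewrite -dRD !addr0. Qed.

Lemma dR1 : dR 1 = 0.
Proof.
by have := dRM 1 1; rewrite !mulr1 mul1r -[LHS]addr0 => /addrI.
Qed.

Lemma poly_derEw (f : P) (E : {fset {cmonom I}}) : (msupp f `<=` E)%fset ->
  poly_der f = \sum_(m <- E) (<< dR f@_m *g m >> + (f@_m)%:MP * monom_der m).
Proof.
move=> fE; rewrite /poly_der (big_fset_incl _ fE) // => m _.
by move=> /mcoeff_outdom ->; rewrite dR0 !monalgU0 mul0r addr0.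
Qed.

Lemma poly_derD (f g : P) : poly_der (f + g) = poly_der f + poly_der g.
Proof.
pose E := (msupp f `|` msupp g)%fset.
rewrite (@poly_derEw f E) ?fsubsetUl // (@poly_derEw g E) ?fsubsetUr //.
rewrite (@poly_derEw (f + g) E) ?msuppD_le // -big_split /=.
apply: eq_bigr => m _; rewrite mcoeffD dRD !monalgUD mulrDl.
by rewrite addrACA.
Qed.

Lemma poly_der0 : poly_der 0 = 0.
Proof. by apply: (addrI (poly_der 0)); rewrite -poly_derD !addr0. Qed.

Lemma poly_derUE c m :
  poly_der << c *g m >> = << dR c *g m >> + c%:MP * monom_der m.
Proof.
by rewrite (@poly_derEw _ [fset m]%fset) ?msuppU_le // big_seq_fset1 mcoeffUU.
Qed.

Lemma poly_derU c m : poly_der (c%:MP * << m >>)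
  = (dR c)%:MP * << m >> + c%:MP * monom_der m.
Proof. by rewrite [X in poly_der X]malgCU [X in _ = X + _]malgCU poly_derUE. Qed.

Lemma poly_der_const c : poly_der c%:MP = (dR c)%:MP.
Proof. by rewrite poly_derUE monom_der1 mulr0 addr0. Qed.

Lemma poly_der_var v : poly_der << ucm v >> = dI v.
Proof.
by rewrite poly_derUE dR1 monalgU0 add0r mpolyC1E mul1r monom_derU.
Qed.

Lemma poly_derM (f g : P) : poly_der (f * g) = poly_der f * g + f * poly_der g.
Proof.
elim/malg_ind: f => [|f f' IH IH'|a m]; first exact: leibniz0l poly_derD _.
  exact (leibnizDl poly_derD IH IH').
elim/malg_ind: g => [|g g' IH IH'|b m']; first exact: leibniz0r poly_derD _.
  exact (leibnizDr poly_derD IH IH').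
have dCE : (dR (a * b))%:MP
    = (dR a)%:MP * b%:MP + a%:MP * (dR b)%:MP :> P.
  by rewrite dRM monalgUD [X in X + _]mpolyCM [X in _ + X]mpolyCM.
have E := poly_derU (a * b) (m * m')%M; rewrite monom_derM dCE in E.
exact (leibniz_mul (poly_derU a m) (poly_derU b m') (mpolyCM _ a b)
  (esym (malgUM m m')) E).
Qed.

End PolyDerivation.

(* Two derivations commute as soon as they commute on generators. *)
Lemma poly_derC (I : choiceType) (R : comNzRingType) (dR eR : R -> R)
    (dI eI : I -> {malg R[{cmonom I}]}) (D := poly_der dR dI)
    (E := poly_der eR eI) :
  (forall a b, dR (a + b) = dR a + dR b) ->
  (forall a b, dR (a * b) = dR a * b + a * dR b) ->
  (forall a b, eR (a + b) = eR a + eR b) ->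
  (forall a b, eR (a * b) = eR a * b + a * eR b) ->
  (forall a, dR (eR a) = eR (dR a)) ->
  (forall v, D (eI v) = E (dI v)) -> forall f, D (E f) = E (D f).
Proof.
move=> dRD dRM eRD eRM C CI.
have DD := poly_derD dI dRD; have ED := poly_derD eI eRD.
have DM := poly_derM dI dRD dRM; have EM := poly_derM eI eRD eRM.
rewrite -/D -/E in DD DM ED EM.
elim/malg_ind => [|f g IH IH'|c m]; first by rewrite /D /E !poly_der0.
  exact (der_commD DD ED IH IH').
have Cc a : D (E a%:MP) = E (D a%:MP).
  have Dc b : D b%:MP = (dR b)%:MP by exact (poly_der_const dI dRD b).
  have Ec b : E b%:MP = (eR b)%:MP by exact (poly_der_const eI eRD b).
  exact (etrans (congr1 D (Ec a)) (etrans (Dc _)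
    (etrans (congr1 malgC (C a)) (esym (etrans (congr1 E (Dc a)) (Ec _)))))).
have Cv v : D (E << ucm v >>) = E (D << ucm v >>).
  have Dv := poly_der_var dI dRD dRM v; have Ev := poly_der_var eI eRD eRM v.
  exact (etrans (congr1 D Ev) (etrans (CI v) (esym (congr1 E Dv)))).
apply: (der_commM DD DM ED EM (Cc c)).
elim/cmonom_ind: m => [|v m IH]; first exact: Cc.
by rewrite -malgUM; exact (der_commM DD DM ED EM (Cv v) IH).
Qed.

(* The pair [(i, t)] stands for the variable [t y_i]. *)
Definition jet (Delta : finType) (n : nat) : choiceType :=
  ('I_n * {cmonom Delta})%type.

Definition diffpoly (Delta : finType) (R : diffRingType Delta) (n : nat) : Type :=
  {malg R[{cmonom (jet Delta n)}]}.
HB.instance Definition _ Delta R n := GRing.ComNzRing.on (@diffpoly Delta R n).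

Section DiffPoly.
Context {Delta : finType} {R : diffRingType Delta} {n : nat}.

Definition jet_der (d : Delta) (v : jet Delta n) : jet Delta n :=
  (v.1, (ucm d * v.2)%M).

Definition diffpoly_der (d : Delta) : diffpoly R n -> diffpoly R n :=
  poly_der (der d) (fun v => << ucm (jet_der d v) >>).

Lemma diffpoly_derD d (f g : diffpoly R n) :
  diffpoly_der d (f + g) = diffpoly_der d f + diffpoly_der d g.
Proof. exact: poly_derD (derD d) _ _. Qed.

Lemma diffpoly_derM d (f g : diffpoly R n) :
  diffpoly_der d (f * g) = diffpoly_der d f * g + f * diffpoly_der d g.
Proof. exact: poly_derM (derD d) (derM d) _ _. Qed.

Lemma diffpoly_derC d e (f : diffpoly R n) :
  diffpoly_der d (diffpoly_der e f) = diffpoly_der e (diffpoly_der d f).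
Proof.
apply: poly_derC.
- exact: derD.
- exact: derM.
- exact: derD.
- exact: derM.
- exact: derC.
move=> v; rewrite (poly_der_var _ (derD d) (derM d)).
rewrite (poly_der_var _ (derD e) (derM e)) /jet_der /=.
by rewrite !mulmA (mulmC (ucm d)).
Qed.

HB.instance Definition _ := ComNzRing_isDifferential.Build Delta
  (diffpoly R n) diffpoly_derD diffpoly_derM diffpoly_derC.

End DiffPoly.

Definition affine_space (Delta : finType) (R : diffRingType Delta) (n : nat)
  : Type := {ffun 'I_n -> R}.
HB.instance Definition _ Delta R n := Choice.on (@affine_space Delta R n).

Section Zeros.
Context {Delta : finType} {R : diffRingType Delta} {n : nat}.
Implicit Types (x : affine_space R n) (f : diffpoly R n).

Definition monom_eval x (m : {cmonom (jet Delta n)}) : R :=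
  \prod_(v <- finsupp m) dop v.2 ((x : {ffun _}) v.1) ^+ m v.

Definition diffpoly_eval x f : R := mmap idfun (monom_eval x) f.

Definition zeros (E : set (diffpoly R n)) : set (affine_space R n) :=
  [set x | forall f, E f -> diffpoly_eval x f = 0].

Definition vanishing (X : set (affine_space R n)) : set (diffpoly R n) :=
  [set f | forall x, X x -> diffpoly_eval x f = 0].

Definition quasivariety (X : set (affine_space R n)) : Prop :=
  exists E, X = zeros E.

Lemma monom_eval_mmorphism x : mmorphism (monom_eval x).
Proof.
have evalEw (m : {cmonom (jet Delta n)}) (E : {fset jet Delta n}) : (finsupp m `<=` E)%fset ->
    monom_eval x m = \prod_(v <- E) dop v.2 ((x : {ffun _}) v.1) ^+ m v.
  move=> mE; rewrite /monom_eval (big_fset_incl _ mE) // => v _.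
  by rewrite -cmE_neq0 negbK => /eqP ->; rewrite expr0.
split=> [m m'|]; last by rewrite /monom_eval mdom1 big_seq_fset0.
pose E := (finsupp m `|` finsupp m')%fset.
rewrite (evalEw m E) ?fsubsetUl // (evalEw m' E) ?fsubsetUr //.
rewrite (evalEw _ E) ?mdomD // -big_split /=.
by apply: eq_bigr => v _; rewrite cmM exprD.
Qed.

HB.instance Definition _ x :=
  isMultiplicative.Build _ R (monom_eval x) (monom_eval_mmorphism x).

Lemma diffpoly_evalD x f g :
  diffpoly_eval x (f + g) = diffpoly_eval x f + diffpoly_eval x g.
Proof. exact: mmapD. Qed.

Lemma diffpoly_evalM x f g :
  diffpoly_eval x (f * g) = diffpoly_eval x f * diffpoly_eval x g.
Proof. exact: rmorphM. Qed.

Lemma diffpoly_eval_const x c : diffpoly_eval x (c%:MP : {malg R[_]}) = c.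
Proof. exact: mmapC. Qed.

Lemma diffpoly_eval_var x i t :
  diffpoly_eval x (<< ucm ((i, t) : jet Delta n) >> : {malg R[_]})
  = dop t ((x : {ffun _}) i).
Proof.
rewrite /diffpoly_eval mmapU mul1r /monom_eval mdomU big_seq_fset1.
by rewrite cmUU expr1.
Qed.

Lemma diffpoly_eval_der x d f :
  diffpoly_eval x (der d f) = der d (diffpoly_eval x f).
Proof.
have evalM (g h : diffpoly R n) :
    diffpoly_eval x (der d g) = der d (diffpoly_eval x g) ->
    diffpoly_eval x (der d h) = der d (diffpoly_eval x h) ->
    diffpoly_eval x (der d (g * h)) = der d (diffpoly_eval x (g * h)).
  exact (leibniz_morph (diffpoly_evalD x) (diffpoly_evalM x)
    (@derM _ (diffpoly R n) d) (@derM _ R d)).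
have eval_const c : diffpoly_eval x (der d (c%:MP : diffpoly R n))
    = der d (diffpoly_eval x (c%:MP : {malg R[_]})).
  have E : der d (c%:MP : diffpoly R n) = (der d c)%:MP.
    exact (poly_der_const _ (derD d) c).
  exact (etrans (congr1 (diffpoly_eval x) E) (etrans
    (diffpoly_eval_const _ _) (esym (congr1 (der d) (diffpoly_eval_const x c))))).
have eval_var v : diffpoly_eval x (der d (<< ucm v >> : diffpoly R n))
    = der d (diffpoly_eval x (<< ucm v >> : {malg R[_]})).
  have E : der d (<< ucm v >> : diffpoly R n) = << ucm (jet_der d v) >>.
    exact (poly_der_var _ (derD d) (derM d) v).
  case: v => i t in E *; exact (etrans (congr1 (diffpoly_eval x) E)
    (etrans (diffpoly_eval_var x i (ucm d * t)%M)
    (etrans (dopU _ _ _) (esym (congr1 (der d) (diffpoly_eval_var x i t)))))).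
elim/malg_ind: f => [|f g IH IH'|c m].
- have E0 : diffpoly_eval x 0 = 0 by exact: mmap0.
  have E1 : der d (0 : diffpoly R n) = 0 by exact: raddf0.
  by rewrite E1 E0 raddf0.
- have E1 := derD d (f : diffpoly R n) (g : diffpoly R n).
  have E2 := diffpoly_evalD x f g.
  have E3 := diffpoly_evalD x (der d (f : diffpoly R n))
    (der d (g : diffpoly R n)).
  exact (etrans (congr1 (diffpoly_eval x) E1) (etrans E3
    (etrans (congr2 +%R IH IH') (esym (etrans (congr1 (der d) E2) (derD d _ _)))))).
apply: (evalM _ _ (eval_const c)).
elim/cmonom_ind: m => [|v m IH]; first exact (eval_const 1).
by rewrite -malgUM; exact (evalM _ _ (eval_var v) IH).
Qed.

Lemma diffpoly_eval_dop x t f :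
  diffpoly_eval x (dop t f) = dop t (diffpoly_eval x f).
Proof.
rewrite /dop; elim: (enum Delta) => //= d s <-.
by elim: (t d) => //= k <-; rewrite diffpoly_eval_der.
Qed.

End Zeros.

Definition differentially_closed (Delta : finType) (Q : quasifieldType Delta) :=
  forall (n : nat) (a : set (diffpoly Q n)),
    diff_ideal a -> drad a = vanishing (zeros a).

Section Topology.
Context {Delta : finType} {Q : quasifieldType Delta} {n : nat}.

Definition affine_open (U : set (affine_space Q n)) : Prop :=
  quasivariety (~` U).

Lemma quasivarietyP (X : set (affine_space Q n)) :
  quasivariety X <-> zeros (vanishing X) `<=` X.
Proof.
split=> [[E ->] x xE f fE|sX]; first by apply: xE => y; apply.
by exists (vanishing X); apply/seteqP; split=> // x Xx f; apply.
Qed.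

(* [Q] may have zero divisors; this replaces integrality in the proof that a
   finite union of sets of zeros is a set of zeros. *)
Lemma mul_dop_neq0 (u v : Q) : u != 0 -> v != 0 -> exists t, u * dop t v != 0.
Proof.
move=> u0 v0; apply: contrapT => uv.
pose A := [set x : Q | forall t, x * dop t v = 0].
have Au : A u by move=> t; apply/eqP; apply: contra_notT uv; exists t.
have idA : diff_ideal A.
  split=> [t|x y Ax Ay t|a x Ax t|d x Ax t]; first by rewrite mul0r.
  - by rewrite mulrDl Ax Ay addr0.
  - by rewrite -mulrA Ax mulr0.
  - have := derM d x (dop t v); rewrite -dopU !Ax raddf0 addr0.
    by move/esym.
case: (diff_simple _ idA) => A0.
  by move: Au; rewrite A0 /= => /eqP; rewrite (negbTE u0).
have : A 1 by rewrite A0.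
by move=> /(_ 1%M); rewrite mul1r dop1; apply/eqP.
Qed.

Lemma affine_openT : affine_open setT.
Proof.
by exists setT; rewrite setCT; apply/seteqP; split=> // x /(_ 1%:MP I);
  rewrite diffpoly_eval_const => /eqP; rewrite oner_eq0.
Qed.

Lemma affine_openI : setI_closed affine_open.
Proof.
move=> U V /quasivarietyP oU /quasivarietyP oV; apply/quasivarietyP => x xUV.
rewrite setCI; apply: contrapT => /not_orP[xU xV].
have {}xU : ~ zeros (vanishing (~` U)) x by move=> /oU.
have {}xV : ~ zeros (vanishing (~` V)) x by move=> /oV.
move: xU xV => /existsNP[f /not_implyP[fU /eqP fx]].
move=> /existsNP[g /not_implyP[gV /eqP gx]].
have [t /eqP] := mul_dop_neq0 fx gx; apply.
rewrite -diffpoly_eval_dop -diffpoly_evalM; apply: xUV => y.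
rewrite setCI diffpoly_evalM diffpoly_eval_dop => -[/fU ->|/gV ->].
  by rewrite mul0r.
by rewrite dop0 mulr0.
Qed.

Lemma affine_open_bigU (J : Type) (U : J -> set (affine_space Q n)) :
  (forall j, affine_open (U j)) -> affine_open (\bigcup_j U j).
Proof.
move=> oU; apply/quasivarietyP => x xU [j _ Ujx].
move/quasivarietyP: (oU j) => /(_ x); apply => // f fU.
by apply: xU => y yU; apply: fU => Ujy; apply: yU; exists j.
Qed.

HB.instance Definition _ := isOpenTopological.Build (affine_space Q n)
  affine_openT affine_openI affine_open_bigU.

Lemma closed_affineP (X : set (affine_space Q n)) :
  closed X <-> quasivariety X.
Proof. by rewrite -openC /open /= /affine_open setCK. Qed.

End Topology.

Definition irreducible (T : topologicalType) : Prop :=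
  [set: T] !=set0 /\
  forall A B : set T, closed A -> closed B -> A `|` B = setT ->
    A = setT \/ B = setT.

(* Main.v *)
(* If [m] is the characteristic, every [m]-th power is a constant, so in [Q] it
   is either [0] or invertible.  Since [rad (I X) = I X], a dense open subset of
   [X] contains a nonempty set [{x in X | h x ^ m <> 0}] for some differential
   polynomial [h].  Given countably many such [h_i], adjoin one differential
   indeterminate [z], fix a derivation [d], and impose on [(x, z)] that [x] lies
   in [X] and that [(d^i z * h_i x)^m = 1] for all [i].  The left-hand sides
   [(d^i z * h_i)^m - 1] are constants, so together with [I X] they generate a
   differential ideal algebraically; that it is proper can thus be tested with
   finitely many [i] and with specializations sending the jets of [z] to
   arbitrary elements of [Q], and it follows from irreducibility.  As [Q] is
   differentially closed, the ideal has a zero [(x, z)], and [h_i x <> 0] for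
   all [i]. *)
Require Import Defs.
From HB Require Import structures.
From mathcomp Require Import all_boot all_algebra finmap monalg.
From mathcomp Require Import boolp classical_sets cardinality.
From mathcomp Require Import topology_structure initial_topology.
From mathcomp Require Import subtype_topology.

Set Implicit Arguments.
Unset Strict Implicit.
Unset Printing Implicit Defensive.

Import GRing.Theory.
Local Open Scope classical_set_scope.
Local Open Scope ring_scope.

(** * Derivative operators and the constancy of [m]-th powers *)

Section DiffRingTheory.
Context {Delta : finType} {R : diffRingType Delta}.
Implicit Types (x y : R) (t : {cmonom Delta}) (d : Delta).

Lemma dop_der t d x : dop t (der d x) = dop (mmul (ucm d) t) x.
Proof.
rewrite dopU; elim/cmonom_ind: t => [|e t IH]; first by rewrite !dop1.
by rewrite !dopU IH derC.
Qed.

Lemma dopD t x y : dop t (x + y) = dop t x + dop t y.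
Proof.
elim/cmonom_ind: t => [|e t IH]; first by rewrite !dop1.
by rewrite !dopU IH derD.
Qed.

Lemma dop_const t x : (forall d, der d x = 0) -> t != mone -> dop t x = 0.
Proof.
move=> dx; elim/cmonom_ind: t => [|e t _ _]; first by rewrite eqxx.
by rewrite -dop_der dx dop0.
Qed.

(** This is the largest differential ideal inside an ordinary ideal [J]. For products, induct on [t]
    with both factors general: one derivation turns [a * x] into a sum of two such products. *)
Lemma diff_ideal_core (J : set R) :
    J 0 -> (forall x y, J x -> J y -> J (x + y)) ->
    (forall a x, J x -> J (a * x)) ->
  diff_ideal [set x | forall t, J (dop t x)].
Proof.
move=> J0 JD JM; split=> [t|x y Jx Jy t|a x Jx t|d x Jx t].
- by rewrite dop0.
- by rewrite dopD; apply: JD.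
- elim/cmonom_ind: t a x Jx => [|d t IH] a x Jx.
    by rewrite dop1; apply: JM; rewrite -[x]dop1.
  rewrite -dop_der derM dopD; apply: JD; apply: IH => // s.
  by rewrite dop_der.
- by rewrite dop_der.
Qed.

Lemma der_exp d x k : der d (x ^+ k) = x ^+ k.-1 * der d x *+ k.
Proof.
case: k => [|k]; first by rewrite expr0 mulr0n der1.
elim: k => [|k IH]; first by rewrite expr1 mul1r.
rewrite exprS derM IH /= [RHS]mulrS exprS mulrC; congr (_ + _).
by rewrite mulrnAr mulrA -exprS.
Qed.

Lemma der_exp_char m d x : m%:R = 0 :> R -> der d (x ^+ m) = 0.
Proof. by move=> m0; rewrite der_exp -mulr_natl m0 mul0r. Qed.

Lemma dop_exp_sub1 m x t :
  m%:R = 0 :> R -> t != mone -> dop t (x ^+ m - 1) = 0.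
Proof.
move=> m0; apply: dop_const => d.
by rewrite raddfB /= der_exp_char // der1 subrr.
Qed.

End DiffRingTheory.

(** As [u ^+ m] is a constant, its multiples already form a differential ideal, which by simplicity
    contains 1. *)
Lemma quasifield_exp_unit (Delta : finType) (Q : quasifieldType Delta) m
    (u : Q) :
  (0 < m)%N -> m%:R = 0 :> Q -> u ^+ m != 0 -> exists v, u * v = 1.
Proof.
move=> m_gt0 m0 um0.
have idI : diff_ideal [set x | exists a, x = a * u ^+ m].
  split=> [|x y [a ->] [b ->]|b x [a ->]|d x [a ->]].
  - by exists 0; rewrite mul0r.
  - by exists (a + b); rewrite mulrDl.
  - by exists (b * a); rewrite mulrA.
  - by exists (der d a); rewrite derM der_exp_char // mulr0 addr0.
case: (diff_simple _ idI) => [I0|IT].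
  have : [set x | exists a, x = a * u ^+ m] (u ^+ m) by exists 1; rewrite mul1r.
  by rewrite I0 /= => /eqP; rewrite (negbTE um0).
have [a aE] : [set x | exists a, x = a * u ^+ m] 1 by rewrite IT.
by exists (a * u ^+ m.-1); rewrite mulrCA -exprS prednK.
Qed.

Lemma rmorph_exp_sub1 (A B : comNzRingType) (f : {rmorphism A -> B}) x y m :
  f ((x * y) ^+ m - 1) = (f x * f y) ^+ m - 1.
Proof. by rewrite rmorphB rmorphXn rmorphM rmorph1. Qed.

(** * Universal property of polynomial rings *)

Section MalgLift.
Context {I : choiceType} {R A : comNzRingType}.
Implicit Types (c : {rmorphism R -> A}) (g : I -> A).

Definition cmonom_lift g (m : {cmonom I}) : A :=
  \prod_(v <- finsupp m) g v ^+ m v.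

Lemma cmonom_lift_mmorphism g : mmorphism (cmonom_lift g).
Proof.
have liftEw (m : {cmonom I}) (E : {fset I}) : (finsupp m `<=` E)%fset ->
    cmonom_lift g m = \prod_(v <- E) g v ^+ m v.
  move=> mE; rewrite /cmonom_lift (big_fset_incl _ mE) // => v _.
  by rewrite -cmE_neq0 negbK => /eqP ->; rewrite expr0.
split=> [m m'|]; last by rewrite /cmonom_lift mdom1 big_seq_fset0.
pose E := (finsupp m `|` finsupp m')%fset.
rewrite (liftEw m E) ?fsubsetUl // (liftEw m' E) ?fsubsetUr //.
rewrite (liftEw _ E) ?mdomD // -big_split /=.
by apply: eq_bigr => v _; rewrite cmM exprD.
Qed.

HB.instance Definition _ g :=
  isMultiplicative.Build _ A (cmonom_lift g) (cmonom_lift_mmorphism g).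

Definition malg_lift c g : {malg R[{cmonom I}]} -> A := mmap c (cmonom_lift g).

HB.instance Definition _ c g := GRing.RMorphism.on (malg_lift c g).

Lemma malg_lift_const c g a : malg_lift c g a%:MP = c a.
Proof. exact: mmapC. Qed.

Lemma malg_lift_var c g v : malg_lift c g << ucm v >> = g v.
Proof.
rewrite /malg_lift mmapU [X in X * _](rmorph1 c) mul1r.
by rewrite /cmonom_lift mdomU big_seq_fset1 cmUU expr1.
Qed.

Lemma malg_ext (h h' : {malg R[{cmonom I}]} -> A) :
    (forall p q, h (p + q) = h p + h q) ->
    (forall p q, h (p * q) = h p * h q) ->
    (forall p q, h' (p + q) = h' p + h' q) ->
    (forall p q, h' (p * q) = h' p * h' q) ->
    (forall a, h a%:MP = h' a%:MP) ->
    (forall v, h << ucm v >> = h' << ucm v >>) ->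
  h =1 h'.
Proof.
move=> hD hM h'D h'M hC hv.
elim/malg_ind => [|p q IHp IHq|a m].
- have z (k : {malg R[{cmonom I}]} -> A) :
      (forall p q, k (p + q) = k p + k q) -> k 0 = 0.
    by move=> kD; apply: (addrI (k 0)); rewrite -kD !addr0.
  by rewrite (z _ hD) (z _ h'D).
- by rewrite hD h'D IHp IHq.
- have hm : h << m >> = h' << m >>.
    elim/cmonom_ind: m => [|v m IH]; first exact: hC.
    rewrite -malgUM.
    exact (etrans (hM _ _) (etrans (congr2 *%R (hv v) IH) (esym (h'M _ _)))).
  exact (etrans (hM _ _) (etrans (congr2 *%R (hC a) hm) (esym (h'M _ _)))).
Qed.

End MalgLift.

(** * Adjoining one differential indeterminate and specializing its jets *)

Section Widening.
Context {Delta : finType} {Q : quasifieldType Delta} {n : nat}.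
Implicit Types (x : affine_space Q n) (w : {cmonom Delta} -> Q).

HB.instance Definition _ x :=
  GRing.RMorphism.copy (diffpoly_eval x) (mmap idfun (monom_eval x)).

Lemma diffpoly_char m : m%:R = 0 :> Q -> m%:R = 0 :> diffpoly Q n.
Proof.
move=> m0; rewrite -(rmorph_nat (malgC : {rmorphism Q -> diffpoly Q n}) m) m0.
exact: raddf0.
Qed.

(** The index [ord_max] is left free for the new indeterminate. *)
Definition widen_jet (v : jet Delta n) : jet Delta n.+1 :=
  (lift ord_max v.1, v.2).

Definition widen : diffpoly Q n -> diffpoly Q n.+1 :=
  malg_lift (malgC : Q -> diffpoly Q n.+1) (fun v => << ucm (widen_jet v) >>).

Lemma widenD (f g : diffpoly Q n) : widen (f + g) = widen f + widen g.
Proof. exact: raddfD. Qed.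

Lemma widenM (f g : diffpoly Q n) : widen (f * g) = widen f * widen g.
Proof. exact: rmorphM. Qed.

Lemma widen_const c : widen c%:MP = c%:MP.
Proof. exact: malg_lift_const. Qed.

Lemma widen_var v : widen << ucm v >> = << ucm (widen_jet v) >>.
Proof. exact: malg_lift_var. Qed.

Lemma widen_der d f : widen (der d f) = der d (widen f).
Proof.
have widM (g h : diffpoly Q n) :
    widen (der d g) = der d (widen g) -> widen (der d h) = der d (widen h) ->
    widen (der d (g * h)) = der d (widen (g * h)).
  exact (leibniz_morph widenD widenM
    (@derM _ (diffpoly Q n) d) (@derM _ (diffpoly Q n.+1) d)).
have wid_const c : widen (der d (c%:MP : diffpoly Q n)) = der d (widen c%:MP).
  have E k : der d (c%:MP : diffpoly Q k) = (der d c)%:MP.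
    exact (poly_der_const _ (derD d) c).
  exact (etrans (congr1 widen (E n)) (etrans (widen_const _)
    (esym (etrans (congr1 (der d) (widen_const c)) (E n.+1))))).
have wid_var v : widen (der d (<< ucm v >> : diffpoly Q n))
    = der d (widen << ucm v >>).
  have E k (u : jet Delta k) :
      der d (<< ucm u >> : diffpoly Q k) = << ucm (jet_der d u) >>.
    exact (poly_der_var _ (derD d) (derM d) u).
  exact (etrans (congr1 widen (E n v)) (etrans (widen_var (jet_der d v))
    (esym (etrans (congr1 (der d) (widen_var v)) (E n.+1 (widen_jet v)))))).
elim/malg_ind: f => [|f g IH IH'|c m].
- have E k : der d (0 : diffpoly Q k) = 0 by exact: raddf0.
  have E0 : widen 0 = 0 by exact: raddf0.
  exact (etrans (congr1 widen (E n)) (etrans E0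
    (esym (etrans (congr1 (der d) E0) (E n.+1))))).
- exact (etrans (congr1 widen (derD d (f : diffpoly Q n) (g : diffpoly Q n)))
    (etrans (widenD _ _) (etrans (congr2 +%R IH IH')
    (esym (etrans (congr1 (der d) (widenD f g)) (derD d _ _)))))).
apply: (widM _ _ (wid_const c)).
elim/cmonom_ind: m => [|v m IH]; first exact (wid_const 1).
by rewrite -malgUM; exact (widM _ _ (wid_var v) IH).
Qed.

Lemma widen_dop t f : widen (dop t f) = dop t (widen f).
Proof.
elim/cmonom_ind: t => [|d t IH].
  by rewrite (@dop1 _ (diffpoly Q n)) (@dop1 _ (diffpoly Q n.+1)).
rewrite (@dopU _ (diffpoly Q n)) (@dopU _ (diffpoly Q n.+1)).
by rewrite widen_der IH.
Qed.

(* The jets of the last variable are sent to arbitrary elements of [Q], so that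
   this ring morphism need not commute with the derivations. *)
Definition spec_jet x w (v : jet Delta n.+1) : Q :=
  if unlift ord_max v.1 is Some i then dop v.2 ((x : {ffun _}) i) else w v.2.

Definition spec x w : diffpoly Q n.+1 -> Q := malg_lift idfun (spec_jet x w).

HB.instance Definition _ x w := GRing.RMorphism.on (spec x w).

Lemma spec_widen x w f : spec x w (widen f) = diffpoly_eval x f.
Proof.
move: f; apply: malg_ext => [f g|f g|f g|f g|c|[i t]].
- by rewrite widenD; exact: raddfD.
- by rewrite widenM; exact: rmorphM.
- exact: diffpoly_evalD.
- exact: diffpoly_evalM.
- by rewrite widen_const diffpoly_eval_const; exact: malg_lift_const.
- rewrite widen_var diffpoly_eval_var; apply: etrans (malg_lift_var _ _ _) _.
  by rewrite /spec_jet liftK.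
Qed.

Lemma spec_last x w t :
  spec x w << ucm ((ord_max, t) : jet Delta n.+1) >> = w t.
Proof.
by apply: etrans (malg_lift_var _ _ _) _; rewrite /spec_jet unlift_none.
Qed.

Definition restrict_point (x : affine_space Q n.+1) : affine_space Q n :=
  [ffun i => (x : {ffun _}) (lift ord_max i)].

Lemma eval_widen (x : affine_space Q n.+1) f :
  diffpoly_eval x (widen f) = diffpoly_eval (restrict_point x) f.
Proof.
move: f; apply: malg_ext => [f g|f g|f g|f g|c|[i t]].
- by rewrite widenD; exact: diffpoly_evalD.
- by rewrite widenM; exact: diffpoly_evalM.
- exact: diffpoly_evalD.
- exact: diffpoly_evalM.
- by rewrite widen_const !diffpoly_eval_const.
- by rewrite widen_var !diffpoly_eval_var ffunE.
Qed.

End Widening.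

(** * From finitely many nonvanishing conditions to countably many *)

Section CommonPoint.
Context {Delta : finType} {Q : quasifieldType Delta} {n : nat}.
Variables (hDelta : (0 < #|Delta|)%N) (hQ : differentially_closed Q).
Variables (X : set (affine_space Q n)) (hX : quasivariety X).
Variables (m : nat) (m_gt0 : (0 < m)%N) (m0 : m%:R = 0 :> Q).
Variable h : nat -> diffpoly Q n.

(** Nonemptiness of [Delta] provides infinitely many operators, told apart by their degree. *)
Let t i : {cmonom Delta} :=
  iter i (mmul (ucm (enum_val (Ordinal hDelta)))) mone.

Let tK i : mdeg (t i) = i.
Proof. by elim: i => [|i IH]; rewrite /= ?mdeg1 // mdegM mdegU IH. Qed.

Let inverted N x w :=
  forall i, (i <= N)%N -> w (t i) * diffpoly_eval x (h i) = 1.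

(** An ordinary ideal, since two bounds have a common maximum. It contains [vanishing X] (widened)
    and the equations for all [h i], yet its properness is tested at one finite [N] at a time. *)
Let J : set (diffpoly Q n.+1) :=
  [set f | exists N, forall x w, X x -> inverted N x w -> spec x w f = 0].

(** Specializations need not respect derivations, so [J] is cut down to its differential core. *)
Let a : set (diffpoly Q n.+1) := [set f | forall s, J (dop s f)].

Let a_ideal : diff_ideal a.
Proof.
apply: diff_ideal_core.
- by exists 0 => x w _ _; exact: raddf0.
- move=> f g [N fN] [M gM]; exists (maxn N M) => x w Xx xw.
  have fg : spec x w (f + g) = spec x w f + spec x w g by exact: raddfD.
  by rewrite fg fN ?gM ?addr0 // => i iN; apply: xw; rewrite leq_max iN ?orbT.
- move=> b f [N fN]; exists N => x w Xx xw.
  have bf : spec x w (b * f) = spec x w b * spec x w f by exact: rmorphM.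
  by rewrite bf fN // mulr0.
Qed.

Let a_vanishing f : vanishing X f -> a (widen f).
Proof.
move=> fX s; exists 0 => x w Xx _.
by rewrite -widen_dop spec_widen diffpoly_eval_dop fX // dop0.
Qed.

Let z i : diffpoly Q n.+1 := << ucm ((ord_max, t i) : jet Delta n.+1) >>.

(* An [m]-th power is a constant, so the inequations [h i <> 0] can be imposed
   on the independent jets of a single new variable. *)
Let a_inverse i : a ((z i * widen (h i)) ^+ m - 1).
Proof.
move=> s; have [->|s1] := eqVneq s mone; last first.
  rewrite (dop_exp_sub1 _ (diffpoly_char m0)) //.
  by exists 0 => x w _ _; exact: raddf0.
rewrite dop1; exists i => x w Xx xw.
have E : spec x w ((z i * widen (h i)) ^+ m - 1)
    = (spec x w (z i) * spec x w (widen (h i))) ^+ m - 1.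
  exact: rmorph_exp_sub1.
by rewrite E spec_widen [X in X * _]spec_last xw // expr1n subrr.
Qed.

Lemma common_nonzero :
    (forall N, exists2 x, X x &
       forall i, (i <= N)%N -> diffpoly_eval x (h i) ^+ m != 0) ->
  exists2 x, X x & forall i, diffpoly_eval x (h i) != 0.
Proof.
move=> hN.
(* Otherwise differential closedness puts 1 into [J] with some bound [N], refuted by specializing at
   a point where [h 0], ..., [h N] have invertible values. *)
have [x ax] : zeros a !=set0.
  apply/set0P/eqP => a0.
  have : drad a 1 by rewrite hQ // a0 => x.
  move=> /(_ mone) [k]; rewrite dop1 expr1n => /(_ mone) [N].
  rewrite dop1; have [x Xx xN] := hN N.
  (* Inverses matter only up to [N]; beyond it 0 is a dummy value. *)
  have u i : exists v, (i <= N)%N -> v * diffpoly_eval x (h i) = 1.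
    have [iN|_] := leqP i N; last by exists 0.
    have [v uv] := quasifield_exp_unit m_gt0 m0 (xN i iN).
    by exists v; rewrite mulrC.
  have [v vE] := choice u.
  (* As [t i] has degree [i], composing with [mdeg] gives its jet the value [v i]. *)
  move=> /(_ x (v \o mdeg) Xx); rewrite rmorph1 => one0.
  by have /eqP := one0 (fun i => ltac:(rewrite /= tK; exact: vE));
    rewrite oner_eq0.
exists (restrict_point x).
  apply: (iffLR (quasivarietyP X) hX) => f /a_vanishing /ax.
  by rewrite eval_widen.
move=> i; have /ax := a_inverse i.
have -> : diffpoly_eval x ((z i * widen (h i)) ^+ m - 1)
    = (diffpoly_eval x (z i) * diffpoly_eval x (widen (h i))) ^+ m - 1.
  exact: rmorph_exp_sub1.
rewrite eval_widen => /eqP.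
(* If [h i] vanished at the point, the equation would read [0 ^+ m - 1 = 0]. *)
apply: contraTneq => ->.
by rewrite mulr0 expr0n eqn0Ngt m_gt0 sub0r oppr_eq0 oner_eq0.
Qed.

End CommonPoint.

(** * Dense open subsets and irreducibility *)

Section Open.
Context {Delta : finType} {Q : quasifieldType Delta} {n : nat}.
Variables (X : set (affine_space Q n)).

(** An equation [f] of the complement of [U] might take only nilpotent values on [X]. Since
    [vanishing X] is its own [drad], some [dop t f] has an [m]-th power that is nonzero somewhere on
    [X], and it still vanishes wherever [f] does. *)
Lemma dense_open_nonzero m (U : set X) : (0 < m)%N ->
    differentially_closed Q -> quasivariety X -> irreducible X ->
    open U -> dense U ->
  exists h : diffpoly Q n,
    (exists2 x, X x & diffpoly_eval x h ^+ m != 0) /\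
    (forall x : X, diffpoly_eval (val x) h != 0 -> U x).
Proof.
move=> m_gt0 hQ hX [X0 _] [V [E VE] <-] /(_ _ X0 openT) [x0 [_ Vx0]].
have [f Ef fx0] : exists2 f, E f & diffpoly_eval (val x0) f != 0.
  apply: contrapT => /forall2NP fE; suff : (~` V) (val x0) by apply.
  by rewrite VE => f Ef; have [//|/negP/negPn/eqP] := fE f.
have IX : drad (vanishing X) = vanishing X.
  (* [X] and [zeros (vanishing X)] have the same vanishing polynomials. *)
  rewrite hQ.
    by apply/seteqP; split=> g gX x Xx; [apply: gX => k; apply|exact: Xx].
  split=> [x _|g k gX kX x Xx|b g gX x Xx|d g gX x Xx].
  - exact: mmap0.
  - by rewrite diffpoly_evalD gX ?kX ?addr0.
  - by rewrite diffpoly_evalM gX ?mulr0.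
  - by rewrite diffpoly_eval_der gX ?raddf0.
have : ~ drad (vanishing X) f.
  by rewrite IX => /(_ _ (set_valP x0)); apply/eqP.
move=> /existsNP[t /forallNP /(_ m) /existsNP[x /not_implyP[Xx fx]]].
exists (dop t f); split.
  exists x => //; apply/eqP; move: fx.
  by rewrite [X in ~ X = _ -> _](rmorphXn (diffpoly_eval x)).
move=> y; rewrite diffpoly_eval_dop; apply: contraNP => Vy.
have : (~` V) (val y) by [].
by rewrite VE => /(_ _ Ef) ->; rewrite dop0.
Qed.

(** The zero sets of the [g i] are proper closed subsets of [X], and irreducibility keeps finite
    unions of them proper. *)
Lemma irreducible_nonzero (g : nat -> diffpoly Q n) : irreducible X ->
    (forall i, exists2 x, X x & diffpoly_eval x (g i) != 0) ->
  forall N, exists2 x, X x &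
    forall i, (i <= N)%N -> diffpoly_eval x (g i) != 0.
Proof.
move=> [_ Xirr] gX N.
pose Z i : set X := [set x | diffpoly_eval (val x) (g i) = 0].
have Z_closed i : closed (Z i).
  rewrite -openC; exists (~` zeros [set g i]).
    by rewrite /open /= /affine_open setCK; exists [set g i].
  apply/seteqP; split=> x /= Zx gx; apply: Zx; first by move=> _ ->.
  exact: gx.
have ZT i : Z i <> setT.
  move=> ZE; have [x Xx /eqP] := gX i; apply.
  have : Z i (SigSub (mem_set Xx)) by rewrite ZE.
  by [].
pose C N := [set x | exists2 i, (i <= N)%N & Z i x].
have CS k : C k.+1 = C k `|` Z k.+1.
  apply/seteqP; split=> x /=.
    by move=> [i]; rewrite leq_eqVlt => /orP[/eqP->|ik]; [right|left; exists i].
  by move=> [[i ik]|]; [exists i => //; apply: leqW|exists k.+1].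
have C0 : C 0 = Z 0.
  apply/seteqP; split=> x; last by exists 0.
  by move=> [i]; rewrite leqn0 => /eqP ->.
have [C_closed CT] : closed (C N) /\ C N <> setT.
  elim: N => [|k [kC kT]]; first by rewrite C0; split.
  rewrite CS; split; first exact: closedU.
  by move=> /(Xirr _ _ kC (Z_closed _)) [|/ZT].
have [x Cx] : exists x, ~ C N x.
  by apply/existsNP => CN; apply: CT; apply/seteqP; split.
exists (val x); first exact: set_valP.
by move=> i iN; apply/eqP => gx; apply: Cx; exists i.
Qed.

End Open.

Theorem theorem29 (Delta : finType) (hDelta : (0 < #|Delta|)%N)
    (Q : quasifieldType Delta) (hQ : differentially_closed Q)
    (n : nat) (X : set (affine_space Q n))
    (hX : quasivariety X) (hirr : irreducible X)
    (F : set (set X)) (hF : countable F)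
    (hdense : forall U : set X, F U -> open U /\ dense U) :
  \bigcap_(U in F) U !=set0.
Proof.
have [m m_gt0 m0] := @char_neq0 _ Q.
have /countable_injP[e e_inj] := hF.
have : forall i, exists h : diffpoly Q n,
    (exists2 x, X x & diffpoly_eval x h ^+ m != 0) /\
    (forall U, F U -> e U = i ->
       forall x : X, diffpoly_eval (val x) h != 0 -> U x).
  move=> i; have [[U [FU Ui]]|FN] := pselect (exists U, F U /\ e U = i).
    have [oU dU] := hdense U FU.
    have [h [hx hU]] := dense_open_nonzero m_gt0 hQ hX hirr oU dU.
    exists h; split=> // V FV Vi; suff -> : V = U by [].
    by apply: e_inj; rewrite ?inE // Vi.
  (* A number not attained by [e] on [F] imposes no condition, so the constant 1 serves. *)
  exists 1; split; last by move=> U FU Ui; case: FN; exists U.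
  have [[x _] _] := hirr; exists (val x); first exact: set_valP.
  by rewrite rmorph1 expr1n oner_neq0.
move=> /choice[h hP].
have hN : forall N, exists2 x, X x &
    forall i, (i <= N)%N -> diffpoly_eval x (h i) ^+ m != 0.
  move=> N.
  (* The powers [h i ^+ m] are used because their nonvanishing, unlike that of [h i], ensures
     invertible values. *)
  have [i|x Xx xN] := irreducible_nonzero (g := fun i => h i ^+ m) hirr _ N.
    have [[x Xx hx] _] := hP i; exists x => //.
    by rewrite [X in X != _](rmorphXn (diffpoly_eval x)).
  exists x => // i iN; have := xN i iN.
  by rewrite [X in X != _](rmorphXn (diffpoly_eval x)).
have [x Xx hx] := common_nonzero hDelta hQ hX m_gt0 m0 hN.
exists (SigSub (mem_set Xx)) => U FU.
by have [_ hU] := hP (e U); apply: (hU U FU erefl); apply: hx.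
Qed.
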